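(* Fix $T>0$. The following holds for the basic neural ODE architecture $\mathrm{NODE}_{(1)}$ used to embed maps $x\mapsto cx^\alpha$, depending on the coefficient $c\in\mathbb{R}$ and the exponent $\alpha\in\mathbb{R}_{\geq 0}$. (a) For $\alpha=0$: let $\Phi:\mathbb{R}\to\mathbb{R}$, $x\mapsto c$. Then, under Assumptions 1 and 2, there exists no basic neural ODE embedding $\Phi$ as its time-$T$ map. (b) For $\alpha=1$: let $\Phi:\mathbb{R}\to\mathbb{R}$, $x\mapsto cx$. If $c>0$, the linear function $f(h)=\frac{\ln(c)}{T}h$ leads to the basic neural ODE $h'=f(h)$, $h(0)=x$ with time-$T$ map $h_x(T)=cx$. If $c\leq 0$, then under Assumptions 1 and 2 no basic neural ODE with time-$T$ map $\Phi$ exists. (c) Let $\Phi:\mathbb{R}_{>0}\to\mathbb{R}_{>0}$, $x\mapsto cx^\alpha$ with $c>0$ and $\alpha\notin\{0,1\}$. Then the neural ODE $$\frac{dh}{dt}=\frac{\ln(\alpha)}{T}\,h\,\ln\left(c^{1/(\alpha-1)}h\right),\qquad h(0)=x>0,$$ has for all $t\geq 0$ the solution $$h_x(t)=c^{1/(1-\alpha)}\left(x\,c^{1/(\alpha-1)}\right)^{\alpha^{t/T}}$$ with time-$T$ map $h_x(T)=\Phi(x)=cx^\alpha$.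
   Context: A (one-dimensional) basic neural ODE is the initial value problem $\frac{dh}{dt}=f(h(t),t)$, $h(0)=x\in\mathcal{X}\subset\mathbb{R}$, with $f:\mathbb{R}\times[0,T]\to\mathbb{R}$ continuous (in (c), the vector field is considered on $h>0$). Its solution is denoted $h_x$; the time-$T$ map, which is the output of the architecture, is $\mathrm{NODE}_{(1)}(x):=h_x(T)$. A map $\Phi$ on $\mathcal{X}$ is embedded if $\Phi(x)=h_x(T)$ for all $x\in\mathcal{X}$. Assumption 1: the vector field $f$ is continuous and the solution of the initial value problem exists for all $t\in[0,T]$. Assumption 2: the vector field $f$ is continuous and the solution of the initial value problem is unique for all $t\in\mathcal{I}$, where $\mathcal{I}$ is the maximal time interval of existence; uniqueness is understood in the sense that solution curves do not cross (two solutions of the ODE that agree at some time agree at all times at which both exist). *)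

(* Defs.v *)
From Stdlib Require Import Reals.
From Coquelicot Require Import Coquelicot.

Open Scope R_scope.

(* A vector field is a total function [f h t]; only its values for [h] in the
   state space [D] and [t] in the relevant time interval matter. *)

Definition whole_line : R -> Prop := fun _ => True.
Definition half_line : R -> Prop := fun x => 0 < x.

Definition horizon (T : R) : R -> Prop := fun t => 0 <= t <= T.

(* Intervals may be open, closed, half-open, bounded or not. *)
Definition is_interval (I : R -> Prop) : Prop :=
  forall r s t, I r -> I t -> r <= s <= t -> I s.

Definition continuous_field (T : R) (D : R -> Prop) (f : R -> R -> R) : Prop :=
  continuous_on (fun p : R * R => D (fst p) /\ horizon T (snd p))
                (fun p : R * R => f (fst p) (snd p)).

(* [D_in] is the derivative relative to [I], hence one-sided at those
   endpoints that belong to [I]. *)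
Definition solves (D : R -> Prop) (f : R -> R -> R) (I : R -> Prop)
    (h : R -> R) : Prop :=
  forall t, I t -> D (h t) /\ D_in h (fun s => f (h s) s) I t.

Definition solves_ivp (D : R -> Prop) (f : R -> R -> R) (I : R -> Prop)
    (x : R) (h : R -> R) : Prop :=
  solves D f I h /\ h 0 = x.

Definition assumption1 (T : R) (X D : R -> Prop) (f : R -> R -> R) : Prop :=
  continuous_field T D f /\
  forall x, X x -> exists h, solves_ivp D f (horizon T) x h.

(* The two solutions may live on different subintervals of [[0, T]] and need
   not be defined at time 0; in particular this covers solutions on their
   maximal intervals of existence. *)
Definition assumption2 (T : R) (D : R -> Prop) (f : R -> R -> R) : Prop :=
  continuous_field T D f /\
  forall (I J : R -> Prop) (u v : R -> R),
    is_interval I -> is_interval J ->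
    (forall t, I t -> horizon T t) -> (forall t, J t -> horizon T t) ->
    solves D f I u -> solves D f J v ->
    (exists s, I s /\ J s /\ u s = v s) ->
    forall t, I t -> J t -> u t = v t.

(* [y] is the value at time [T] of the solution starting at [x]: a solution
   exists on [[0, T]], and [y] does not depend on the choice of it. *)
Definition is_NODE (T : R) (D : R -> Prop) (f : R -> R -> R) (x y : R) : Prop :=
  (exists h, solves_ivp D f (horizon T) x h) /\
  (forall h, solves_ivp D f (horizon T) x h -> h T = y).

Definition embeds (T : R) (X D : R -> Prop) (f : R -> R -> R)
    (Phi : R -> R) : Prop :=
  continuous_field T D f /\ forall x, X x -> is_NODE T D f x (Phi x).

(* On [0 < x] the real power [x ^ a] is [Rpower x a]. *)

Definition power_field (T c alpha : R) : R -> R -> R :=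
  fun h _ => ln alpha / T * h * ln (Rpower c (1 / (alpha - 1)) * h).

Definition power_flow (T c alpha x : R) : R -> R :=
  fun t => Rpower c (1 / (1 - alpha))
           * Rpower (x * Rpower c (1 / (alpha - 1))) (Rpower alpha (t / T)).

(* Main.v *)
Require Import Defs.
From Stdlib Require Import Reals Lra.
From Coquelicot Require Import Coquelicot.

Open Scope R_scope.

(** The negative results have one cause: in dimension one, solution curves that
    cannot cross keep their order, so the time-[T] map of a neural ODE with
    unique solutions is strictly increasing ([NODE_strictly_increasing]).  If
    two solutions starting at [x < y] had [u T >= v T], the intermediate value
    theorem would make them meet, and uniqueness would carry the meeting point
    back to time 0, where they differ.  Constant maps and [x |-> c * x] with
    [c <= 0] are not strictly increasing.

    The positive results reduce to the linear equation [w' = a * w], whose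
    solutions are [w 0 * exp (a * t)] because [w t * exp (- a * t)] has zero
    derivative ([linear_ode_unique]).  This is the linear case directly.  In the
    power case put [k = c ^ (1 / (alpha - 1))]: the substitution
    [w = ln (k * h)] turns the equation into [w' = (ln alpha / T) * w], so that
    over the time [T] the quantity [ln (k * h)] is multiplied by [alpha].
    Hence [h T = k ^ (alpha - 1) * x ^ alpha = c * x ^ alpha], the factor [k]
    having been chosen to make [k ^ (alpha - 1) = c]. *)

(** * Derivatives relative to a set *)

Lemma D_in_subset (I J : R -> Prop) (h d : R -> R) (t : R) :
  (forall s, J s -> I s) -> D_in h d I t -> D_in h d J t.
Proof.
  intros HJI Hd eps Heps.
  destruct (Hd eps Heps) as [del [Hdel H]].
  exists del; split; [exact Hdel|].
  intros s [[HJ Hne] Hs]. apply H. repeat split; auto.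
Qed.

Lemma is_derive_D_in (I : R -> Prop) (h d : R -> R) (t : R) :
  is_derive h t (d t) -> D_in h d I t.
Proof.
  intros Hd. apply D_in_subset with no_cond; [intros; exact Logic.I|].
  apply derivable_pt_lim_D_in, is_derive_Reals, Hd.
Qed.

Lemma D_in_is_derive (T : R) (h d : R -> R) (t : R) :
  0 < t < T -> D_in h d (horizon T) t -> is_derive h t (d t).
Proof.
  intros Ht Hd. apply is_derive_Reals, derivable_pt_lim_D_in.
  intros eps Heps. destruct (Hd eps Heps) as [del [Hdel H]].
  exists (Rmin del (Rmin t (T - t))). split.
  { repeat apply Rmin_pos; lra. }
  intros s [[_ Hne] Hs].
  assert (H1 := Rmin_l del (Rmin t (T - t))).
  assert (H2 := Rmin_r del (Rmin t (T - t))).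
  assert (H3 := Rmin_l t (T - t)). assert (H4 := Rmin_r t (T - t)).
  simpl in Hs |- *. unfold Rdist in Hs.
  apply H. split; [split; [|exact Hne]|].
  - apply Rabs_def2 in Hs. unfold horizon. lra.
  - simpl. unfold Rdist. lra.
Qed.

Lemma D_in_comp (I : R -> Prop) (h d g : R -> R) (t l : R) :
  D_in h d I t -> is_derive g (h t) l ->
  D_in (fun s => g (h s)) (fun s => d s * l) I t.
Proof.
  intros Hh Hg.
  apply D_in_subset with (Dgf I no_cond h).
  { intros s Hs. split; [exact Hs|exact Logic.I]. }
  apply (Dcomp I no_cond d (fun _ => l) h g t Hh).
  apply derivable_pt_lim_D_in, is_derive_Reals, Hg.
Qed.

Definition clamp (T t : R) : R := Rmax 0 (Rmin T t).

Lemma clamp_horizon (T t : R) : 0 <= T -> horizon T (clamp T t).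
Proof.
  intros HT. unfold clamp, horizon, Rmax, Rmin.
  destruct (Rle_dec T t), (Rle_dec 0 _); lra.
Qed.

Lemma clamp_id (T t : R) : horizon T t -> clamp T t = t.
Proof.
  unfold clamp, horizon, Rmax, Rmin.
  destruct (Rle_dec T t), (Rle_dec 0 _); lra.
Qed.

Lemma clamp_contract (T s t : R) :
  Rabs (clamp T s - clamp T t) <= Rabs (s - t).
Proof.
  unfold clamp, Rmax, Rmin.
  destruct (Rle_dec T s), (Rle_dec T t);
    repeat destruct (Rle_dec 0 _); unfold Rabs;
    repeat destruct (Rcase_abs _); lra.
Qed.

(** A solution on [[0, T]] is only constrained there, while the intermediate
    and mean value theorems ask for two-sided continuity at the endpoints.
    Extending it by its boundary values supplies that. *)
Lemma clamp_continuity (T : R) (h d : R -> R) :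
  0 <= T -> (forall t, horizon T t -> D_in h d (horizon T) t) ->
  continuity (fun t => h (clamp T t)).
Proof.
  intros HT Hd t eps Heps.
  assert (Hc := cont_deriv _ _ _ _ (Hd _ (clamp_horizon T t HT))).
  destruct (Hc eps Heps) as [del [Hdel H]].
  exists del. split; [exact Hdel|].
  intros s [_ Hs]. simpl in *.
  destruct (Req_dec (clamp T t) (clamp T s)) as [Heq|Hne].
  - rewrite Heq. unfold Rdist. rewrite Rminus_diag, Rabs_R0. exact Heps.
  - apply H. split; [split; [apply clamp_horizon, HT|exact Hne]|].
    unfold Rdist in *.
    apply Rle_lt_trans with (2 := Hs). apply clamp_contract.
Qed.

(** * Order preservation *)

(** By the intermediate value theorem two solutions whose order got reversed
    have met in between, and uniqueness then makes their initial values agree.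
    The non-strict reversal [Phi y <= Phi x] is excluded at once, since meeting
    at time [T] is a meeting too; this is what rules out constant maps. *)
Lemma NODE_strictly_increasing (T : R) (X D : R -> Prop) (f : R -> R -> R)
    (Phi : R -> R) (x y : R) :
  0 <= T -> assumption2 T D f -> embeds T X D f Phi ->
  X x -> X y -> x < y -> Phi x < Phi y.
Proof.
  intros HT [_ Huniq] [_ Hemb] Xx Xy Hxy.
  destruct (Hemb x Xx) as [[u Hu] HuT]. destruct (Hemb y Xy) as [[v Hv] HvT].
  specialize (HuT u Hu). specialize (HvT v Hv).
  destruct Hu as [Hu Hu0]. destruct Hv as [Hv Hv0].
  assert (H0 : horizon T 0) by (unfold horizon; lra).
  assert (HTT : horizon T T) by (unfold horizon; lra).
  destruct (Rlt_or_le (Phi x) (Phi y)) as [Hlt|Hle]; [exact Hlt|exfalso].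
  assert (Hmeet : exists s, horizon T s /\ u s = v s).
  { set (g := fun t => u (clamp T t) - v (clamp T t)).
    assert (Hg : continuity g).
    { apply continuity_minus.
      - apply clamp_continuity with (fun s => f (u s) s); [exact HT|].
        intros t Ht. apply Hu, Ht.
      - apply clamp_continuity with (fun s => f (v s) s); [exact HT|].
        intros t Ht. apply Hv, Ht. }
    destruct (IVT_gen g 0 T 0 Hg) as [s [Hs Hgs]].
    { unfold g. rewrite !clamp_id by assumption.
      rewrite HuT, HvT, Hu0, Hv0.
      rewrite Rmin_left, Rmax_right; lra. }
    rewrite Rmin_left, Rmax_right in Hs by lra.
    exists s. split; [exact Hs|].
    unfold g in Hgs. rewrite clamp_id in Hgs by exact Hs. lra. }
  destruct Hmeet as [s [Hs Hus]].
  assert (Hint : is_interval (horizon T)).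
  { unfold is_interval, horizon. intros; lra. }
  assert (H := Huniq (horizon T) (horizon T) u v Hint Hint
                 (fun _ H => H) (fun _ H => H) Hu Hv
                 (ex_intro _ s (conj Hs (conj Hs Hus))) 0 H0 H0).
  lra.
Qed.

(** * Linear equations *)

(** The product of [w] with [exp (- a * t)] has zero derivative, so the mean
    value theorem equates its values at 0 and [T]. *)
Lemma linear_ode_unique (a T : R) (w : R -> R) :
  0 <= T ->
  (forall t, horizon T t -> D_in w (fun s => a * w s) (horizon T) t) ->
  w T = w 0 * exp (a * T).
Proof.
  intros HT Hw.
  set (g := fun t => w (clamp T t) * exp (- a * t)).
  assert (Hg : g T - g 0 = 0).
  { destruct (MVT_gen g 0 T (fun _ => 0)) as [s [_ Hs]].
    - rewrite Rmin_left, Rmax_right by lra. intros t Ht.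
      apply is_derive_ext_loc with (fun s => w s * exp (- a * s)).
      { assert (Hd : 0 < Rmin t (T - t)) by (apply Rmin_pos; lra).
        exists (mkposreal _ Hd). intros s Hs.
        change (Rabs (s - t) < Rmin t (T - t)) in Hs. apply Rabs_def2 in Hs.
        assert (H1 := Rmin_l t (T - t)). assert (H2 := Rmin_r t (T - t)).
        unfold g. rewrite clamp_id; [reflexivity|unfold horizon; lra]. }
      assert (Hd : is_derive w t (a * w t)).
      { apply (D_in_is_derive T w (fun s => a * w s)); [exact Ht|].
        apply Hw. unfold horizon; lra. }
      auto_derive.
      + exists (a * w t). exact Hd.
      + replace (Derive (fun x => w x) t) with (a * w t)
          by (symmetry; apply is_derive_unique, Hd).
        ring.
    - intros t _. apply continuity_pt_mult.
      + apply clamp_continuity with (fun s => a * w s); assumption.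
      + apply derivable_continuous_pt. exists (- a * exp (- a * t)).
        apply is_derive_Reals. auto_derive; [exact Logic.I|ring].
    - lra. }
  unfold g in Hg. rewrite !clamp_id in Hg by (unfold horizon; lra).
  rewrite Rmult_0_r, exp_0 in Hg.
  replace (w 0) with (w T * exp (- a * T)) by lra.
  rewrite Rmult_assoc, <- exp_plus.
  replace (- a * T + a * T) with 0 by ring.
  rewrite exp_0. ring.
Qed.

Lemma autonomous_continuous_field (T : R) (D : R -> Prop) (g : R -> R) :
  (forall h, D h -> continuous g h) ->
  continuous_field T D (fun h _ => g h).
Proof.
  intros Hg. apply continuous_on_forall. intros p [Hp _].
  apply (continuous_comp fst g); [apply continuous_fst|apply Hg, Hp].
Qed.

Lemma linear_embeds (T c : R) :
  0 < T -> 0 < c ->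
  embeds T whole_line whole_line (fun h _ => ln c / T * h) (fun x => c * x).
Proof.
  intros HT Hc. split.
  { apply (autonomous_continuous_field T whole_line (fun h => ln c / T * h)).
    intros h _. apply (ex_derive_continuous (V := R_NormedModule)).
    auto_derive. exact Logic.I. }
  intros x _. split.
  - exists (fun t => x * exp (ln c / T * t)). split.
    + intros t _. split; [exact Logic.I|].
      apply is_derive_D_in. auto_derive; [exact Logic.I|]. ring.
    + rewrite Rmult_0_r, exp_0. ring.
  - intros h [Hh Hh0].
    rewrite (linear_ode_unique (ln c / T) T h); [|lra|intros t Ht; apply Hh, Ht].
    replace (ln c / T * T) with (ln c) by (field; lra).
    rewrite exp_ln by exact Hc. rewrite Hh0. ring.
Qed.

(** * The power field *)

Section PowerField.

Variables T c alpha : R.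
Hypotheses (hT : 0 < T) (hc : 0 < c) (halpha : 0 < alpha) (halpha1 : alpha <> 1).

Let k := Rpower c (1 / (alpha - 1)).

Lemma power_scale_pos : 0 < k.
Proof. apply exp_pos. Qed.

(** The flow in the coordinate [ln (k * h)] that makes the equation linear. *)
Lemma power_flow_exp (x t : R) :
  power_flow T c alpha x t
  = / k * exp (ln (k * x) * exp (ln alpha / T * t)).
Proof.
  unfold power_flow. fold k. f_equal.
  (* [c ^ (1 / (1 - alpha))] is the inverse of [k]. *)
  - unfold k. rewrite <- Rpower_Ropp. f_equal. field. lra.
  - unfold Rpower at 1. rewrite (Rmult_comm x k), Rmult_comm.
    unfold Rpower. do 3 f_equal. field. lra.
Qed.

Lemma power_flow_pos (x t : R) : 0 < power_flow T c alpha x t.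
Proof.
  rewrite power_flow_exp. apply Rmult_lt_0_compat; [|apply exp_pos].
  apply Rinv_0_lt_compat, power_scale_pos.
Qed.

Lemma power_flow_derive (x t : R) :
  is_derive (power_flow T c alpha x) t
    (power_field T c alpha (power_flow T c alpha x t) t).
Proof.
  assert (Hk := power_scale_pos).
  unfold power_field. fold k.
  apply is_derive_ext
    with (fun s => / k * exp (ln (k * x) * exp (ln alpha / T * s))).
  { intros s. rewrite power_flow_exp. reflexivity. }
  rewrite power_flow_exp.
  rewrite <- Rmult_assoc with (r1 := k), Rinv_r, Rmult_1_l, ln_exp by lra.
  auto_derive; [exact Logic.I|]. ring.
Qed.

Lemma power_flow_solves (I : R -> Prop) (x : R) :
  0 < x ->
  solves_ivp half_line (power_field T c alpha) I x (power_flow T c alpha x).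
Proof.
  intros Hx. assert (Hk := power_scale_pos). split.
  - intros t _. split; [apply power_flow_pos|].
    apply is_derive_D_in, power_flow_derive.
  - rewrite power_flow_exp, Rmult_0_r, exp_0, Rmult_1_r.
    rewrite exp_ln by (apply Rmult_lt_0_compat; assumption).
    field. lra.
Qed.

(** Positivity of [h] allows the coordinate [ln (k * h)], in which
    [linear_ode_unique] applies. *)
Lemma power_flow_unique (x t : R) (h : R -> R) :
  0 <= t ->
  solves_ivp half_line (power_field T c alpha) (horizon t) x h ->
  h t = power_flow T c alpha x t.
Proof.
  intros Ht [Hh Hh0]. assert (Hk := power_scale_pos).
  assert (Hw := linear_ode_unique (ln alpha / T) t (fun s => ln (k * h s)) Ht).
  rewrite power_flow_exp, <- Hh0. rewrite <- Hw.
  - assert (Hpos : 0 < h t) by (apply (Hh t); unfold horizon; lra).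
    rewrite exp_ln by (apply Rmult_lt_0_compat; assumption).
    field. lra.
  - intros s Hs. destruct (Hh s Hs) as [Hpos Hd].
    assert (Hln : is_derive (fun y => ln (k * y)) (h s) (/ h s)).
    { auto_derive; [apply Rmult_lt_0_compat; assumption|].
      field. unfold half_line in Hpos. lra. }
    assert (H := D_in_comp _ _ _ _ _ _ Hd Hln).
    unfold D_in in H |- *.
    replace (ln alpha / T * ln (k * h s))
      with (power_field T c alpha (h s) s * / h s); [exact H|].
    unfold power_field. fold k. field. unfold half_line in Hpos. lra.
Qed.

Lemma power_flow_end (x : R) :
  0 < x -> power_flow T c alpha x T = c * Rpower x alpha.
Proof.
  intros Hx. assert (Hk := power_scale_pos).
  rewrite power_flow_exp.
  replace (ln alpha / T * T) with (ln alpha) by (field; lra).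
  rewrite exp_ln, ln_mult by assumption.
  unfold k, Rpower. rewrite ln_exp, <- exp_Ropp, <- exp_plus.
  rewrite <- (exp_ln c) at 3 by exact hc. rewrite <- exp_plus.
  f_equal. field. lra.
Qed.

Lemma power_embeds :
  embeds T half_line half_line (power_field T c alpha)
    (fun x => c * Rpower x alpha).
Proof.
  assert (Hk := power_scale_pos). split.
  - apply (autonomous_continuous_field T half_line
             (fun h => ln alpha / T * h * ln (k * h))).
    intros h Hh. apply (ex_derive_continuous (V := R_NormedModule)).
    auto_derive. apply Rmult_lt_0_compat; assumption.
  - intros x Hx. split.
    + exists (power_flow T c alpha x). apply power_flow_solves, Hx.
    + intros h Hh. rewrite <- power_flow_end by exact Hx.
      apply power_flow_unique; [lra|exact Hh].
Qed.

End PowerField.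

Theorem theorem2p4 (T : R) (hT : 0 < T) :
  (forall c : R,
     ~ exists f : R -> R -> R,
         assumption1 T whole_line whole_line f /\
         assumption2 T whole_line f /\
         embeds T whole_line whole_line f (fun _ => c))
  /\
  (forall c : R,
     (0 < c ->
        embeds T whole_line whole_line (fun h _ => ln c / T * h)
               (fun x => c * x)) /\
     (c <= 0 ->
        ~ exists f : R -> R -> R,
            assumption1 T whole_line whole_line f /\
            assumption2 T whole_line f /\
            embeds T whole_line whole_line f (fun x => c * x)))
  /\
  (forall c alpha : R, 0 < c -> 0 <= alpha -> alpha <> 0 -> alpha <> 1 ->
     (forall x : R, 0 < x ->
        solves_ivp half_line (power_field T c alpha) (fun t => 0 <= t) x
                   (power_flow T c alpha x) /\
        (forall h : R -> R,
           solves_ivp half_line (power_field T c alpha) (fun t => 0 <= t) x h ->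
           forall t, 0 <= t -> h t = power_flow T c alpha x t) /\
        power_flow T c alpha x T = c * Rpower x alpha) /\
     embeds T half_line half_line (power_field T c alpha)
            (fun x => c * Rpower x alpha)).
Proof.
  split; [|split].
  - intros c [f [_ [H2 He]]].
    assert (H := NODE_strictly_increasing T _ _ f _ 0 1 (Rlt_le _ _ hT) H2 He
                   Logic.I Logic.I Rlt_0_1).
    simpl in H. lra.
  - intros c. split; [apply linear_embeds, hT|].
    intros Hc [f [_ [H2 He]]].
    assert (H := NODE_strictly_increasing T _ _ f _ 0 1 (Rlt_le _ _ hT) H2 He
                   Logic.I Logic.I Rlt_0_1).
    simpl in H. lra.
  - intros c alpha Hc Ha Ha0 Ha1.
    assert (Hpos : 0 < alpha) by lra.
    split; [|apply power_embeds; assumption].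
    intros x Hx. split; [|split].
    + apply power_flow_solves; assumption.
    (* A solution on [[0, +oo)] restricts to one on each [[0, t]]. *)
    + intros h [Hh Hh0] t Ht. apply power_flow_unique; try assumption.
      split; [|exact Hh0].
      intros s Hs. destruct (Hh s (proj1 Hs)) as [Hp Hd].
      split; [exact Hp|].
      apply D_in_subset with (2 := Hd). intros r Hr. apply Hr.
    + apply power_flow_end; assumption.
Qed.
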